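(* Let $X,Y\in\mathcal{D}$ be such that $X\leq_{st}Y$ and $E[X]<E[Y]$, with quantile functions $Q_X,Q_Y$ and quantile densities $q_X,q_Y$. Let $g:(0,1)\to\mathbb{R}$ be a differentiable function such that $g'\cdot Q_X$ and $g'\cdot Q_Y$ are integrable on $(0,1)$. Let $Z^L=\Psi^L(X,Y)$ be an absolutely continuous random variable with values in $(0,1)$ and density $$f_{Z^L}(u)=\frac{Q_Y(u)-Q_X(u)}{E[Y]-E[X]},\qquad 0<u<1.$$ Then $E[g'(Z^L)]$ is finite, and $$E[\{g(1)-g(U)\}\,\{q_Y(U)-q_X(U)\}]=E\left[g'(Z^L)\right]\{E[Y]-E[X]\},$$ where $U$ is uniformly distributed in $[0,1]$.
   Context: For a random variable $X$ with distribution function $F(x)=P(X\le x)$, the quantile function is $Q(u)=\inf\{x\in\mathbb{R}:F(x)\ge u\}$, $0<u<1$, and, if $Q$ is differentiable on $(0,1)$, the quantile density is $q(u)=Q'(u)$, $0<u<1$. $\mathcal{D}$ denotes the family of all absolutely continuous random variables with finite mean whose quantile function satisfies $Q(0)=0$ (where $Q(0):=\lim_{u\downarrow 0}Q(u)$) and whose quantile density exists on $(0,1)$; such random variables are nonnegative with finite nonzero mean. $X\leq_{st}Y$ means $P(X>t)\le P(Y>t)$ for all $t\in\mathbb{R}$, equivalently $Q_X(u)\le Q_Y(u)$ for all $0<u<1$. The value $g(1)$ means $\lim_{u\uparrow 1}g(u)$. *)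

(* Defs.v *)
From HB Require Import structures.
From mathcomp Require Import all_boot all_order all_algebra.
From mathcomp Require Import all_classical all_reals all_analysis.
Set Implicit Arguments.
Unset Strict Implicit.
Unset Printing Implicit Defensive.
Import Order.TTheory GRing.Theory Num.Theory.
Import numFieldNormedType.Exports.
Local Open Scope classical_set_scope.
Local Open Scope ring_scope.

(* Functions on (0,1) are represented by total functions R -> R of which only
   the values on (0,1) matter. For 0 < u < 1 the set below is nonempty and
   bounded from below, so [inf] is the genuine infimum. *)
Definition quantile d (T : measurableType d) (R : realType)
  (P : probability T R) (X : {RV P >-> R}) (u : R) : R :=
  inf [set x : R | (u%:E <= cdf X x)%E].

Definition quantile_density d (T : measurableType d) (R : realType)
  (P : probability T R) (X : {RV P >-> R}) : R -> R :=
  derive1 (quantile X).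

Definition abs_continuous d (T : measurableType d) (R : realType)
  (P : probability T R) (X : {RV P >-> R}) : Prop :=
  distribution P X `<< @lebesgue_measure R.

Definition classD d (T : measurableType d) (R : realType)
  (P : probability T R) (X : {RV P >-> R}) : Prop :=
  [/\ abs_continuous X,
      P.-integrable [set: T] (EFin \o X),
      quantile X u @[u --> (0 : R)^'+] --> (0 : R) &
      forall u : R, 0 < u < 1 -> derivable (quantile X) u 1].

Definition le_st dX (TX : measurableType dX) dY (TY : measurableType dY)
  (R : realType) (PX : probability TX R) (PY : probability TY R)
  (X : {RV PX >-> R}) (Y : {RV PY >-> R}) : Prop :=
  forall t : R, (ccdf X t <= ccdf Y t)%E.

Definition has_density01 d (T : measurableType d) (R : realType)
  (P : probability T R) (Z : {RV P >-> R}) (f : R -> R) : Prop :=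
  (forall w : T, 0 < Z w < 1) /\
  (forall A : set R, measurable A ->
     distribution P Z A =
     (\int[@lebesgue_measure R]_(u in A `&` `]0%R, 1%R[) (f u)%:E)%E).

Definition uniform01 d (T : measurableType d) (R : realType)
  (P : probability T R) (U : {RV P >-> R}) : Prop :=
  (forall w : T, 0 <= U w <= 1) /\
  (forall A : set R, measurable A ->
     distribution P U A = uniform_prob (@ltr01 R) A).

Definition psiL_density dX (TX : measurableType dX) dY (TY : measurableType dY)
  (R : realType) (PX : probability TX R) (PY : probability TY R)
  (X : {RV PX >-> R}) (Y : {RV PY >-> R}) (u : R) : R :=
  (quantile Y u - quantile X u) / (fine 'E_PY[Y] - fine 'E_PX[X]).

(* The value g(1) of a function g on (0,1). *)
Definition at1 (R : realType) (g : R -> R) : R := lim (g u @[u --> (1 : R)^'-]).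

(* Main.v *)
Require Import Defs.
From HB Require Import structures.
From mathcomp Require Import all_boot all_order all_algebra.
From mathcomp Require Import all_classical all_reals all_analysis.
From mathcomp Require Import measurable_realfun lra.
Set Implicit Arguments.
Unset Strict Implicit.
Unset Printing Implicit Defensive.
Import Order.TTheory GRing.Theory Num.Theory.
Import numFieldNormedType.Exports.
Local Open Scope classical_set_scope.
Local Open Scope ring_scope.

(** Write Q for either quantile function and q for its derivative. Since
    g(1) - g(u) is the integral of g' over [u, 1] and Q(t) is the integral of q
    over ]0, t], both the integral of (g(1) - g) q and that of g' Q over ]0, 1[
    are iterated integrals of g'(t) q(u) over the triangle 0 < u <= t < 1.
    Fubini's theorem identifies them; it applies because the iterated integral
    of |g'(t)| q(u) is that of |g'| Q, which is finite. This is
    [by_parts_at1]. Subtracting the identity for X from the one for Y, the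
    right-hand side becomes the integral of g' (Q_Y - Q_X), which is
    E[g'(Z)] (E[Y] - E[X]) by the definition of the density of Z
    ([expectation_density01]), while the left-hand side is an expectation under
    the uniform law ([expectation_uniform01]).

    The functions g, Q_X and Q_Y are only differentiable: g' and q need not be
    continuous, and q is not assumed integrable. So the two
    integral representations rest on the fundamental theorem of calculus for
    functions that are differentiable at every point and whose derivative is
    integrable ([integral_derive1]) or nonnegative ([ge0_integral_derive1]).
    The core is [ge0_derive_le_integral]: a nonnegative w that dominates f' has
    integral at least f(b) - f(a). Each superlevel set of w is covered by a
    slightly larger open set; the measures of these open sets inside [a, x] add
    up to a function of x which, near every point, grows at least as fast as f,
    up to a small slope, and whose total growth barely exceeds the integral of
    w.

    Two facts on quantiles are used. They are nondecreasing, so that q >= 0.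
    They are also positive on ]0, 1[, because an absolutely continuous law has
    no atom at 0 ([quantile_gt0]); hence g' = (g' Q) / Q is integrable on
    [u, 1[ for every u in ]0, 1[, which is why g(1) exists. *)

(** * Monotonicity and difference quotients *)

(** Monotonicity on both sides of every point plays the role of continuity:
    the supremum of the points x with [H a <= H x] inherits that
    inequality from the left, and would pass it on to the right if it were
    below [b]. *)
Lemma locally_nondecreasing_le (R : realType) (a b : R) (H : R -> R) :
  a <= b ->
  (forall x, a <= x <= b -> exists2 d : R, 0 < d &
     (forall y, a <= y <= x -> x - d < y -> H y <= H x) /\
     (forall z, x <= z <= b -> z < x + d -> H x <= H z)) ->
  H a <= H b.
Proof.
move=> ab locH.
pose S := [set x | a <= x <= b /\ H a <= H x].
have Sa : S a by split; rewrite ?lexx.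
have ubS : has_sup S.
  by split; [exists a | exists b => x [/andP[]]].
set c := sup S.
have ac : a <= c by apply: ub_le_sup => //; exact: ubS.2.
have cb : c <= b by apply: ge_sup; [exists a | move=> x [/andP[]]].
have [|d d0 [Hl Hr]] := locH c; first by rewrite ac.
have Hc : H a <= H c.
  have [x [/andP[ax xb] Hx] cdx] := sup_adherent d0 ubS.
  apply: (le_trans Hx); apply: Hl => //; rewrite ax/=.
  by apply: ub_le_sup; [exact: ubS.2 | split => //; rewrite ax].
have [<-//|cb'] := eqVneq c b.
have cltb : c < b by rewrite lt_neqAle cb'.
pose z := Num.min b (c + d / 2).
have cz : c < z by rewrite lt_min cltb/= ltrDl divr_gt0.
have : z <= c.
  apply: ub_le_sup => //; first exact: ubS.2.
  split; first by rewrite ge_min lexx/= andbT (le_trans ac (ltW cz)).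
  apply: (le_trans Hc); apply: Hr; first by rewrite (ltW cz) ge_min lexx.
  by rewrite gt_min; apply/orP; right; rewrite ltrD2l ltr_pdivrMr// ltr_pMr// ltr1n.
by rewrite leNgt cz.
Qed.

(** Both inequalities bound the growth of [f] across [x] from above, with the
    secants on the left of [x] ending at [x]: this is the form that
    [locally_nondecreasing_le] consumes. *)
Lemma derivable_slope_lt (R : realType) (f : R -> R) (x e : R) :
  derivable f x 1 -> 0 < e -> exists2 d : R, 0 < d &
    (forall y, x - d < y -> y <= x -> f x - f y <= (derive1 f x + e) * (x - y)) /\
    (forall z, x <= z -> z < x + d -> f z - f x <= (derive1 f x + e) * (z - x)).
Proof.
move=> fx e0.
have /cvgrPdist_lt/(_ _ e0) : h^-1 *: (f (h *: 1 + x) - f x) @[h --> 0^'] --> derive1 f x.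
  by rewrite derive1E.
move=> [d /= d0 Hd]; exists d => //; split => [y|z].
- rewrite le_eqVlt => xdy /predU1P[->|yx]; first by rewrite !subrr mulr0.
  have := Hd (y - x); rewrite /ball_/= sub0r normrN ltr0_norm ?subr_lt0// opprB.
  move=> /(_ ltac:(lra) ltac:(lra)); rewrite [_%:A]mulr1 subrK ltr_norml => /andP[H _].
  have : (y - x)^-1 *: (f y - f x) < derive1 f x + e by lra.
  rewrite /GRing.scale/= => {}H; rewrite mulrC.
  have -> : f x - f y = (x - y) * ((y - x)^-1 * (f y - f x)).
    by rewrite -(opprB y x) mulrA mulNr divff ?mulN1r ?opprB//; lra.
  by rewrite ler_pM2l ?subr_gt0// ltW.
- rewrite le_eqVlt => /predU1P[->|xz] zd; first by rewrite !subrr mulr0.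
  have := Hd (z - x); rewrite /ball_/= sub0r normrN gtr0_norm ?subr_gt0//.
  move=> /(_ ltac:(lra) ltac:(lra)); rewrite [_%:A]mulr1 subrK ltr_norml => /andP[H _].
  have : (z - x)^-1 *: (f z - f x) < derive1 f x + e by lra.
  rewrite /GRing.scale/= => {}H; rewrite mulrC.
  have -> : f z - f x = (z - x) * ((z - x)^-1 * (f z - f x)).
    by rewrite mulrA divff ?mul1r//; lra.
  by rewrite ler_pM2l ?subr_gt0// ltW.
Qed.

(** * The fundamental theorem of calculus for everywhere differentiable functions *)

(** The layers of height [e] that start below [w] overshoot [w] by at most the
    last one. *)
Lemma sum_layers_le (R : realType) (e w : R) (n : nat) : 0 < e -> 0 <= w ->
  \sum_(k < n) (if k%:R * e <= w then e else 0) <= w + e.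
Proof.
move=> e0 w0.
(* The second bound is what the last nonempty layer needs in the induction. *)
suff [] : \sum_(k < n) (if k%:R * e <= w then e else 0) <= w + e /\
  \sum_(k < n) (if k%:R * e <= w then e else 0) <= n%:R * e by [].
elim: n => [|n [IH1 IH2]]; first by rewrite big_ord0 mul0r addr_ge0// ltW.
rewrite big_ord_recr/= -natr1 mulrDl mul1r.
case: ifPn => h; split.
- by rewrite lerD2r (le_trans IH2).
- by rewrite lerD2r.
- by rewrite addr0.
- by rewrite addr0 (le_trans IH2)// lerDl ltW.
Qed.

Section layers.
Context {R : realType}.
Local Notation mu := (@lebesgue_measure R).

Lemma lebesgue_measure_cc (a b : R) : a <= b -> mu `[a, b] = (b - a)%:E.
Proof.
move=> ab; rewrite lebesgue_measure_itv/= lte_fin.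
by case: ltgtP ab => // ->; rewrite subrr.
Qed.

(** In the spirit of the Vitali-Caratheodory theorem: the sum of the functions
    [e * \1_(U k)] is lower semicontinuous, dominates [w], and its integral
    is close to that of [w]. The set [U k] is an open neighbourhood of
    the superlevel set of [w] at height [k%:R * e], with an excess of measure
    summable in [k]. *)
Lemma open_layers (a b e : R) (w : R -> R) : a <= b -> 0 < e ->
  measurable_fun `[a, b] w -> (forall x, a <= x <= b -> 0 <= w x) ->
  exists U : (set R)^nat, [/\ forall k, open (U k),
    forall k x, a <= x <= b -> k%:R * e <= w x -> U k x &
    (\sum_(k <oo) e%:E * mu (U k `&` `[a, b]) <=
     \int[mu]_(x in `[a, b]) (w x)%:E + (e * (b - a) + e * e)%:E)%E].
Proof.
move=> ab e0 mw w0.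
have mD : measurable (`[a, b] : set R) by exact: measurable_itv.
pose E k := `[a, b] `&` w @^-1` `[k%:R * e, +oo[.
have mE k : measurable (E k) by apply: mw => //; exact: measurable_itv.
have muD := lebesgue_measure_cc ab.
have muE k : (mu (E k) < +oo)%E.
  apply: (@le_lt_trans _ _ (mu `[a, b])); last by rewrite muD ltry.
  by apply: le_measure; rewrite ?inE; [exact: mE|exact: mD|exact: subIsetl].
have e2 k : 0 < e / (2 ^ k.+1)%:R by rewrite divr_gt0// ltr0n expn_gt0.
have /choice[U HU] k := lebesgue_regularity_outer (mE k) (muE k) (e2 k).
exists U; split.
- by move=> k; have [] := HU k.
- move=> k x xab kx; have [_ + _] := HU k; apply.
  by split; rewrite /= in_itv//= kx.
have mU k : measurable (U k) by have [oU _ _] := HU k; exact: open_measurable.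
have le1 k : (e%:E * mu (U k `&` `[a, b]) <=
    e%:E * mu (E k) + (e * e / (2 ^ k.+1)%:R)%:E)%E.
  have [_ EU UE] := HU k.
  rewrite -mulrA EFinM -muleDr//; last first.
    by rewrite ge0_adde_def// inE ?lee_fin// ltW.
  rewrite lee_pmul2l ?lte_fin//.
  apply: (@le_trans _ _ (mu (E k `|` (U k `\` E k)))).
    apply: le_measure; rewrite ?inE.
    - by apply: measurableI; [exact: mU|exact: mD].
    - by apply: measurableU; [exact: mE|apply: measurableD; [exact: mU|exact: mE]].
    - by move=> x [Ux _]; have [Ex|nEx] := pselect (E k x); [left|right].
  apply: (le_trans (measureU2 _ _ _)); [exact: mE|apply: measurableD; [exact: mU|exact: mE]|].
  by rewrite leeD2l// ltW.
apply: (@le_trans _ _ (\sum_(k <oo)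
    (e%:E * mu (E k) + (e * e / (2 ^ k.+1)%:R)%:E))%E).
  by apply: lee_nneseries => // k _; rewrite mule_ge0// lee_fin ltW.
apply: le_trans (epsilon_trick _ _ _) _.
- by move=> k; rewrite mule_ge0// lee_fin ltW.
- by rewrite mulr_ge0// ltW.
rewrite EFinD addeA leeD2r//.
have -> : (\sum_(k <oo) e%:E * mu (E k) =
    \int[mu]_(x in `[a, b]) \sum_(k <oo) (e * \1_(E k) x)%:E)%E.
  rewrite integral_nneseries//.
  - apply: eq_eseriesr => k _.
    under eq_integral do rewrite EFinM.
    rewrite ge0_integralZl//.
    + rewrite integral_indic; [|exact: mD|exact: mE].
      by rewrite setIidl//; exact: subIsetl.
    + by apply/measurable_EFinP; apply: measurable_indic; exact: mE.
    + by rewrite lee_fin ltW.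
  - move=> k; apply/measurable_EFinP/measurable_funM => //.
    by apply: measurable_indic; exact: mE.
  - by move=> k x _; rewrite lee_fin mulr_ge0// ltW.
have -> : (\int[mu]_(x in `[a, b]) (w x)%:E + (e * (b - a))%:E =
    \int[mu]_(x in `[a, b]) (w x + e)%:E)%E.
  under [RHS]eq_integral do rewrite EFinD.
  rewrite ge0_integralD//=.
  - by rewrite integral_cst//= EFinM -muD.
  - exact/measurable_EFinP.
  - by move=> x _; rewrite lee_fin ltW.
apply: ge0_le_integral => //=.
- by move=> x _; apply: nneseries_ge0 => k _ _; rewrite lee_fin mulr_ge0// ltW.
- apply: ge0_emeasurable_sum => k.
    by move=> x _ _; rewrite lee_fin mulr_ge0// ltW.
  move=> _; apply/measurable_EFinP/measurable_funM => //.
  by apply: measurable_indic; exact: mE.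
- by apply/measurable_EFinP/measurable_funD.
move=> x xab.
apply: lime_le.
  by apply: is_cvg_nneseries => k _ _; rewrite lee_fin mulr_ge0// ltW.
apply: nearW => n.
rewrite sumEFin lee_fin big_mkord.
apply: (@le_trans _ R (\sum_(k < n) (if k%:R * e <= w x then e else 0)));
  last exact: sum_layers_le (w0 _ xab).
apply: ler_sum => k _; rewrite indicE.
case: ifPn => h.
  by rewrite ger_pMr//; case: (_ \in _).
rewrite (_ : _ \in _ = false) ?mulr0//.
apply/negbTE; rewrite notin_setE => -[_]/=.
by rewrite in_itv/= andbT (negbTE h).
Qed.

(** Where [N] of the open sets contain [ ]y, z] ], the total measure of the
    layers grows with slope at least [N%:R * e]. *)
Lemma layers_superadditive (U : (set R)^nat) (e a y z : R) (N : nat) :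
  0 < e -> a <= y <= z -> (forall k, open (U k)) ->
  (forall k, (k < N)%N -> `]y, z] `<=` U k) ->
  (\sum_(k <oo) e%:E * mu (U k `&` `[a, y]) + (N%:R * e * (z - y))%:E <=
   \sum_(k <oo) e%:E * mu (U k `&` `[a, z]))%E.
Proof.
move=> e0 /andP[ay yz] oU HU.
have mU k : measurable (U k) by exact: open_measurable.
have ge0 k A : (0 <= e%:E * mu (U k `&` A))%E by rewrite mule_ge0// lee_fin ltW.
have -> : (\sum_(k <oo) e%:E * mu (U k `&` `[a, z]) =
    \sum_(k <oo) e%:E * mu (U k `&` `[a, y]) +
    \sum_(k <oo) e%:E * mu (U k `&` `]y, z]))%E.
  rewrite -nneseriesD//; apply: eq_eseriesr => k _.
  rewrite -muleDr//; last by rewrite ge0_adde_def// inE.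
  congr (_ * _)%E; rewrite -measureU//.
  - rewrite -setIUr; congr (mu (_ `&` _)).
    by rewrite (@itv_bndbnd_setU _ _ _ (BRight y))// bnd_simp.
  - by apply: measurableI; [exact: mU|exact: measurable_itv].
  - by apply: measurableI; [exact: mU|exact: measurable_itv].
  - rewrite setIACA setIid -subset0 => x [_ []]/=; rewrite !in_itv/=.
    by move=> /andP[_ xy] /andP[yx _]; move: xy; rewrite leNgt yx.
rewrite leeD2l//.
apply: le_trans (@nneseries_lim_ge _ _ xpredT 0%N N _) => //.
rewrite big_mkord (eq_bigr (fun=> (e * (z - y))%:E)).
  by rewrite sumEFin sumr_const card_ord lee_fin -mulrA mulr_natl.
move=> k _; rewrite setIidr; last exact: HU.
rewrite lebesgue_measure_itv/= lte_fin EFinM; congr (_ * _)%E.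
by case: ltgtP yz => // ->; rewrite subrr.
Qed.

End layers.

Section derivative_bounds.
Context {R : realType}.
Local Notation mu := (@lebesgue_measure R).

(** With [S x] the total measure of the layers of [open_layers] inside [a, x],
    the function [S x + e * (x - a) - f x] is nondecreasing at each point: near
    [x] at least [w x / e] of the open sets are present, so [S] grows with slope
    at least [w x], hence at least f'(x). Comparing its values at [a] and
    [b] and letting [e] tend to 0 gives the bound. *)
Lemma ge0_derive_le_integral (a b : R) (f w : R -> R) : a <= b ->
  (forall x, a <= x <= b -> derivable f x 1) ->
  measurable_fun `[a, b] w -> (forall x, a <= x <= b -> 0 <= w x) ->
  (forall x, a <= x <= b -> derive1 f x <= w x) ->
  ((f b - f a)%:E <= \int[mu]_(x in `[a, b]) (w x)%:E)%E.
Proof.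
move=> ab df mw w0 fw.
have [->|Ioo] := eqVneq (\int[mu]_(x in `[a, b]) (w x)%:E)%E +oo%E.
  by rewrite leey.
have Ifin : (\int[mu]_(x in `[a, b]) (w x)%:E)%E \is a fin_num.
  rewrite ge0_fin_numE ?ltey//.
  by apply: integral_ge0 => x; rewrite /= in_itv/= lee_fin; exact: w0.
rewrite -(fineK Ifin); set I := fine _; rewrite lee_fin.
suff main e : 0 < e -> f b - f a <= I + (e * (b - a) + e * e) + e * (b - a).
  apply/ler_addgt0Pr => d d0.
  pose e := Num.min 1 (d / (2 * (b - a) + 1)).
  have den0 : 0 < 2 * (b - a) + 1 by lra.
  have e0 : 0 < e by rewrite lt_min ltr01/= divr_gt0.
  apply: le_trans (main e e0) _.
  rewrite -addrA lerD2l.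
  have e1 : e <= 1 by rewrite ge_min lexx.
  have ed : e * (2 * (b - a) + 1) <= d.
    by rewrite -ler_pdivlMr// ge_min lexx orbT.
  have : e * e <= e by rewrite ger_pMr.
  lra.
move=> e0.
have [U [oU wU sumU]] := open_layers ab e0 mw w0.
pose S t := (\sum_(k <oo) e%:E * mu (U k `&` `[a, t]))%E.
have S0 t : (0 <= S t)%E.
  by apply: nneseries_ge0 => k _ _; rewrite mule_ge0// lee_fin ltW.
have SU y z N : a <= y -> y <= z -> (forall k, (k < N)%N -> `]y, z] `<=` U k) ->
    (S y + (N%:R * e * (z - y))%:E <= S z)%E.
  by move=> ay yz yzU; apply: layers_superadditive => //; rewrite ay.
have Sfin t : a <= t <= b -> S t \is a fin_num.
  move=> /andP[at_ tb]; rewrite ge0_fin_numE//.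
  apply: (@le_lt_trans _ _ (S b)).
    by have := SU t b 0%N at_ tb; rewrite !mul0r adde0; apply.
  by rewrite (le_lt_trans sumU)// -(fineK Ifin) -EFinD ltry.
pose H x := fine (S x) + e * (x - a) - f x.
have HG y z N : a <= y -> y <= z -> z <= b ->
    (forall k, (k < N)%N -> `]y, z] `<=` U k) ->
    fine (S y) + N%:R * e * (z - y) <= fine (S z).
  move=> ay yz zb yzU.
  rewrite -lee_fin EFinD !fineK; first exact: SU.
  - by rewrite Sfin// zb (le_trans ay).
  - by rewrite Sfin// ay (le_trans yz).
have : H a <= H b.
  apply: locally_nondecreasing_le => // x xab.
  have [d d0 [fl fr]] := derivable_slope_lt (df x xab) e0.
  (* Exactly the layers of height at most [w x]. *)
  pose N := (Num.truncn (w x / e)).+1.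
  have wN : w x <= N%:R * e.
    by rewrite -ler_pdivrMr// ltW// truncnS_gt.
  have UN k : (k < N)%N -> U k x.
    move=> kN; apply: wU => //; rewrite -ler_pdivlMr//.
    by rewrite -truncn_ge_nat// divr_ge0 ?w0// ltW.
  have [r r0 rU] : exists2 r : R, 0 < r &
      forall k y, (k < N)%N -> `|x - y| < r -> U k y.
    have : \forall y \near x, forall k : 'I_N, U k y.
      apply: (@filter_forall _ _ (fun (k : 'I_N) y => U k y) (nbhs x)) => k.
      by apply: open_nbhs_nbhs; split; [exact: oU|exact: UN].
    case=> r /= r0 rU; exists r => // k y kN xy.
    exact: (rU y xy (Ordinal kN)).
  have fwx := fw x xab.
  move/andP: (xab) => [ax xb].
  exists (Num.min d r); first by rewrite lt_min d0.
  split=> [y /andP[ay yx]|z /andP[xz zb]].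
    rewrite ltrBlDr -ltrBlDl lt_min => /andP[yd yr].
    have := fl y ltac:(lra) yx.
    have : fine (S y) + N%:R * e * (x - y) <= fine (S x).
      apply: HG => // k kN u; rewrite /= in_itv/= => /andP[yu ux].
      by apply: rU => //; rewrite ger0_norm; lra.
    have : (derive1 f x + e) * (x - y) <= (N%:R * e + e) * (x - y).
      by apply: ler_wpM2r; [rewrite subr_ge0|lra].
    by rewrite /H; lra.
  rewrite -ltrBlDl lt_min => /andP[zd zr].
  have := fr z xz ltac:(lra).
  have : fine (S x) + N%:R * e * (z - x) <= fine (S z).
    apply: HG => // k kN u; rewrite /= in_itv/= => /andP[xu uz].
    by apply: rU => //; rewrite ler0_norm; lra.
  have : (derive1 f x + e) * (z - x) <= (N%:R * e + e) * (z - x).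
    by apply: ler_wpM2r; [rewrite subr_ge0|lra].
  by rewrite /H; lra.
have : fine (S b) <= I + (e * (b - a) + e * e).
  rewrite -lee_fin fineK ?Sfin ?ab ?lexx//.
  by rewrite EFinD [I%:E]fineK.
have : 0 <= fine (S a) by rewrite fine_ge0.
rewrite /H; lra.
Qed.

End derivative_bounds.

Section fundamental_theorem.
Context {R : realType}.
Local Notation mu := (@lebesgue_measure R).

(** Truncating [w] below at [- n] and adding the slope [n] to both [f] and [w]
    reduces to [ge0_derive_le_integral]; dominated convergence then removes the
    truncation. *)
Lemma derive_le_integral (a b : R) (f w : R -> R) : a <= b ->
  (forall x, a <= x <= b -> derivable f x 1) ->
  mu.-integrable `[a, b] (EFin \o w) ->
  (forall x, a <= x <= b -> derive1 f x <= w x) ->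
  ((f b - f a)%:E <= \int[mu]_(x in `[a, b]) (w x)%:E)%E.
Proof.
move=> ab df iw fw.
have mw : measurable_fun `[a, b] w.
  by move/integrableP : iw => [/measurable_EFinP].
have mD : measurable (`[a, b] : set R) by exact: measurable_itv.
pose v (n : nat) x : R := Num.max (w x) (- n%:R).
have vw n x : `|v n x| <= `|w x|.
  rewrite /v; case: (leP (w x) (- n%:R)) => // wn.
  by rewrite normrN ger0_norm// ler0_norm; [rewrite lerNr|rewrite (le_trans wn)// oppr_le0].
have muD : (mu `[a, b] < +oo)%E by rewrite lebesgue_measure_cc// ltry.
have mv n : measurable_fun `[a, b] (v n) by apply: measurable_maxr.
have iv n : mu.-integrable `[a, b] (EFin \o v n).
  apply: le_integrable iw => //.
    by apply/measurable_EFinP; exact: mv.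
  by move=> x _; rewrite lee_fin.
have main n : ((f b - f a)%:E <= \int[mu]_(x in `[a, b]) (v n x)%:E)%E.
  have hd x : a <= x <= b ->
      is_derive x 1 (f + (n%:R *: (@id R))) (derive1 f x + n%:R *: 1).
    by move=> /df dfx; rewrite derive1E; apply: is_deriveD; exact: derivableP.
  have ic : mu.-integrable `[a, b] (EFin \o cst n%:R).
    apply: measurable_bounded_integrable => //.
    exists n%:R; split; first exact: num_real.
    by move=> M nM x _ /=; rewrite ger0_norm// ltW.
  have := @ge0_derive_le_integral R a b (f + (n%:R *: (@id R)))
    (fun x => v n x + n%:R) ab.
  have -> : (f + n%:R *: id) b - (f + n%:R *: id) a = f b - f a + n%:R * (b - a).
    by rewrite !fctE /GRing.scale/=; lra.
  rewrite [X in (_ <= X)%E](_ : _ =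
     \int[mu]_(x in `[a, b]) (v n x)%:E + (n%:R * (b - a))%:E)%E; last first.
    rewrite integralD_EFin//; congr (_ + _)%E.
    by rewrite integral_cst// EFinM; congr (_ * _)%E; exact: lebesgue_measure_cc.
  rewrite EFinD leeD2rE//; apply.
  - by move=> x /hd [].
  - exact: measurable_funD.
  - by move=> x _; rewrite -lerBlDr sub0r le_max lexx orbT.
  - move=> x xab; rewrite derive1E; have [_ ->] := hd x xab.
    rewrite [_ *: _]mulr1 lerD2r.
    by rewrite (le_trans (fw x xab))// le_max lexx.
have := @dominated_convergence _ _ _ mu _ mD (fun n => EFin \o v n) (EFin \o w)
  (abse \o (EFin \o w)).
case=> //.
- by move=> n; apply/measurable_EFinP; exact: mv.
- exact/measurable_EFinP.
- apply: aeW => x _; apply: cvg_near_cst.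
  near=> n; congr EFin; apply/max_idPl.
  rewrite lerNl; near: n; exact: nbhs_infty_ger.
- exact: integrable_abse.
- by apply: aeW => x n _; rewrite lee_fin.
move=> _ _; apply: cvge_ge.
by apply: nearW => n; exact: main.
Unshelve. all: by end_near. Qed.

(** The fundamental theorem of calculus for an everywhere differentiable
    function with integrable derivative: [derive_le_integral] for [f] and for
    [- f], with the derivative itself as bound. *)
Lemma integral_derive1 (a b : R) (f : R -> R) : a <= b ->
  (forall x, a <= x <= b -> derivable f x 1) ->
  mu.-integrable `[a, b] (EFin \o derive1 f) ->
  (\int[mu]_(x in `[a, b]) (derive1 f x)%:E = (f b - f a)%:E)%E.
Proof.
move=> ab df iw; apply/eqP; rewrite eq_le; apply/andP; split; last first.
  by apply: derive_le_integral.
rewrite -leeN2 -EFinN.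
have mD : measurable (`[a, b] : set R) by exact: measurable_itv.
rewrite -integralN; last by apply: integrable_add_def.
under eq_integral do rewrite -EFinN.
rewrite (_ : - (f b - f a) = (- f) b - (- f) a); last by rewrite !fctE; lra.
apply: (@derive_le_integral a b (- f) (fun x => - derive1 f x)) => //.
- by move=> x /df; exact: derivableN.
- exact: integrableN iw.
- by move=> x /df dfx; rewrite !derive1E deriveN.
Qed.

(** A nonnegative derivative is automatically integrable: [derive_le_integral],
    applied to [- f] and to the derivative truncated at [n], bounds the
    integrals of the truncations by [f b - f a]. *)
Lemma ge0_integral_derive1 (a b : R) (f : R -> R) : a <= b ->
  (forall x, a <= x <= b -> derivable f x 1) ->
  measurable_fun `[a, b] (derive1 f) ->
  (forall x, a <= x <= b -> 0 <= derive1 f x) ->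
  (\int[mu]_(x in `[a, b]) (derive1 f x)%:E = (f b - f a)%:E)%E.
Proof.
move=> ab df mf f0; apply: integral_derive1 => //.
have mD : measurable (`[a, b] : set R) by exact: measurable_itv.
apply/integrableP; split; first exact/measurable_EFinP.
rewrite (@le_lt_trans _ _ (f b - f a)%:E) ?ltry//.
pose v (n : nat) x := Num.min (derive1 f x) n%:R.
have muD : (mu `[a, b] < +oo)%E by rewrite lebesgue_measure_cc// ltry.
have mv n : measurable_fun `[a, b] (v n) by apply: measurable_minr.
have v0 n x : a <= x <= b -> 0 <= v n x by move=> xab; rewrite le_min f0/=.
have main n : (\int[mu]_(x in `[a, b]) (v n x)%:E <= (f b - f a)%:E)%E.
  have iv : mu.-integrable `[a, b] (EFin \o v n).
    apply: measurable_bounded_integrable => //; first exact: mv.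
    exists n%:R; split; first exact: num_real.
    move=> M nM x; rewrite /= in_itv/= => xab.
    by rewrite ger0_norm ?v0// (le_trans _ (ltW nM))// ge_min lexx orbT.
  rewrite -leeN2 -EFinN -integralN; last by apply: integrable_add_def.
  under eq_integral do rewrite -EFinN.
  rewrite (_ : - (f b - f a) = (- f) b - (- f) a); last by rewrite !fctE; lra.
  apply: (@derive_le_integral a b (- f) (fun x => - v n x)) => //.
  - by move=> x /df; exact: derivableN.
  - exact: integrableN iv.
  - by move=> x /df dfx; rewrite !derive1E deriveN// lerN2 ge_min -derive1E lexx.
have vcvg : (\int[mu]_(x in `[a, b]) (v n x)%:E @[n --> \oo] -->
    \int[mu]_(x in `[a, b]) limn (fun n => (v n x)%:E))%E.
  apply: (@cvg_monotone_convergence _ _ _ mu _ mD (fun n x => (v n x)%:E)).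
  - by move=> n; apply/measurable_EFinP; exact: mv.
  - by move=> n x; rewrite /= in_itv/= => xab; rewrite lee_fin v0.
  - by move=> x _ m n mn; rewrite lee_fin /v le_min !ge_min lexx/= ler_nat mn orbT.
apply: (@le_trans _ _ (\int[mu]_(x in `[a, b]) limn (fun n => (v n x)%:E))%E);
  last by apply: (cvge_le _ vcvg); apply: nearW => n; exact: main.
rewrite le_eqVlt; apply/orP; left; apply/eqP; apply: eq_integral => x.
rewrite inE/= in_itv/= => xab.
rewrite ger0_norm ?f0//; apply/esym/cvg_lim => //; apply: cvg_near_cst.
near=> n; congr EFin; apply/min_idPl.
near: n; exact: nbhs_infty_ger.
Unshelve. all: by end_near. Qed.

End fundamental_theorem.

(** * Derivatives on an open interval *)

Section derivatives_on_open_intervals.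
Context {R : realType}.
Local Notation mu := (@lebesgue_measure R).

Lemma measurable_fun_derivable (a b : R) (f : R -> R) :
  (forall x, a < x < b -> derivable f x 1) -> measurable_fun `]a, b[ f.
Proof.
move=> df; apply: open_continuous_measurable_fun; first exact: interval_open.
move=> x; rewrite inE/= in_itv/= => xab.
by apply/differentiable_continuous/derivable1_diffP; exact: df.
Qed.

Lemma measurable_fun_derive1 (a b : R) (f : R -> R) :
  (forall x, a < x < b -> derivable f x 1) -> measurable_fun `]a, b[ (derive1 f).
Proof.
move=> df.
have mD : measurable (`]a, b[ : set R) by exact: measurable_itv.
pose F := f \_ `]a, b[.
have mF : measurable_fun setT F.
  by apply/(measurable_restrictT f mD); exact: measurable_fun_derivable.
(* Difference quotients of the extension by 0, which are measurable on the line. *)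
pose h (n : nat) (x : R) := n.+1%:R * (F (n.+1%:R^-1 + x) - F x).
apply: (@measurable_fun_cvg _ _ _ _ h).
  move=> n; apply: measurable_funTS; apply: measurable_funM => //.
  apply: measurable_funB => //.
  apply: (measurable_comp measurableT _ mF) => //.
  exact: measurable_funD.
move=> x; rewrite /= in_itv/= => xab.
have dfx := df x xab; move/andP: (xab) => [ax xb].
apply/cvgrPdist_lt => e e0.
have /cvgrPdist_lt/(_ _ e0) :
    h^-1 *: (f (h *: 1 + x) - f x) @[h --> 0^'] --> derive1 f x.
  by rewrite derive1E.
move=> [d /= d0 Hd].
have m0 : 0 < Num.min d (b - x) by rewrite lt_min d0 subr_gt0.
near=> n.
have n0 : 0 < n.+1%:R^-1 :> R by rewrite invr_gt0.
have : n.+1%:R^-1 < Num.min d (b - x).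
  by near: n; exact: (near_infty_natSinv_lt (PosNum m0)).
rewrite lt_min => /andP[nd nb].
have := Hd n.+1%:R^-1; rewrite /ball_/= sub0r normrN gtr0_norm// => /(_ nd).
rewrite gt_eqF// => /(_ isT); rewrite invrK [_%:A]mulr1.
rewrite /h /F !patchE !mem_set//=.
by rewrite in_itv/= -ltrBrDr nb (lt_trans ax)// ltrDr.
Unshelve. all: by end_near. Qed.

Lemma nondecreasing_derive1_ge0 (a b : R) (f : R -> R) (x : R) :
  (forall u v, a < u -> u <= v -> v < b -> f u <= f v) ->
  a < x < b -> derivable f x 1 -> 0 <= derive1 f x.
Proof.
move=> ndf /andP[ax xb] dfx; apply/ler_addgt0Pr => e e0.
have [d d0 [_ fr]] := derivable_slope_lt dfx e0.
have m0 : 0 < Num.min d (b - x) by rewrite lt_min d0 subr_gt0.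
pose r := Num.min d (b - x) / 2.
have r0 : 0 < r by rewrite divr_gt0.
have rm : r < Num.min d (b - x) by rewrite /r; lra.
move: rm; rewrite lt_min => /andP[rd rb].
have := fr (x + r) ltac:(lra) ltac:(lra).
have := ndf x (x + r) ax ltac:(lra) ltac:(lra).
move=> h1 h2.
by rewrite -(pmulr_lge0 _ r0) mulrC; lra.
Qed.

End derivatives_on_open_intervals.

(** * Integration by parts on the unit interval *)

Section unit_interval.
Context {R : realType}.
Local Notation mu := (@lebesgue_measure R).
Local Notation I01 := (`]0, 1[%classic : set R).
Implicit Types g Q k : R -> R.

(** On [u, 1[ the function [k] is at most [(Q u)^-1] times [k * Q] in absolute
    value. The patch
    makes the value of [k] at 1 irrelevant, so that the closed interval can be
    used. *)
Lemma integrable_tail k Q (u : R) : 0 < u < 1 -> 0 < Q u ->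
  (forall v, u <= v < 1 -> Q u <= Q v) ->
  measurable_fun I01 k ->
  mu.-integrable I01 (EFin \o (fun x => k x * Q x)) ->
  mu.-integrable `[u, 1] (EFin \o (k \_ I01)).
Proof.
move=> /andP[u0 u1] Qu Qmon mk ikQ.
have sub : `[u, 1[ `<=` I01.
  by apply: subset_itvr; rewrite bnd_simp.
suff : mu.-integrable `[u, 1[ (EFin \o k).
  rewrite integrable_mkcond// => ik; rewrite integrable_mkcond//.
  rewrite -restrict_EFin -patch_setI (_ : _ `&` _ = `[u, 1[%classic)//.
  apply/seteqP; split=> x; rewrite /= !in_itv/=.
    by move=> [/andP[-> _] /andP[_ ->]].
  by move=> /andP[ux x1]; rewrite ux (ltW x1) x1 (lt_le_trans u0 ux).
have ikQu : mu.-integrable `[u, 1[ (fun x => ((Q u)^-1)%:E * (k x * Q x)%:E)%E.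
  apply: integrableZl; first exact: measurable_itv.
  by apply: integrableS ikQ.
apply: le_integrable ikQu => //.
  by apply/measurable_EFinP; apply: measurable_funS mk.
move=> x; rewrite /= in_itv/= => ux.
rewrite lee_fin normrM (gtr0_norm (_ : 0 < (Q u)^-1)) ?invr_gt0//.
rewrite ler_pdivlMl// normrM mulrC ler_wpM2l//.
by rewrite (le_trans (Qmon x ux))// ler_norm.
Qed.

(** This is where the limit g(1) comes from: the integral of the derivative
    over [u, x] is continuous in [x] up to 1. *)
Lemma cvg_primitive_at1 g (u : R) : 0 < u < 1 ->
  (forall x : R, 0 < x < 1 -> derivable g x 1) ->
  mu.-integrable `[u, 1] (EFin \o (derive1 g \_ I01)) ->
  g x @[x --> 1^'-] -->
    g u + (\int[mu]_(x in `[u, 1]) (derive1 g \_ I01) x)%R.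
Proof.
move=> /andP[u0 u1] dg ig.
have := parameterized_integral_cvg_at_left u1 ig.
move=> /(cvgD (cvg_cst (g u))); apply: cvg_trans; apply: near_eq_cvg.
near=> x.
have ux : u <= x by near: x; exact: nbhs_left_ge.
have x1 : x < 1 by near: x; exact: nbhs_left_lt.
have dgx y : u <= y <= x -> derivable g y 1.
  by move=> /andP[uy yx]; apply: dg; rewrite (lt_le_trans u0 uy) (le_lt_trans yx x1).
have eqG y : `[u, x]%classic y -> (derive1 g \_ I01) y = derive1 g y.
  rewrite /= in_itv/= => /andP[uy yx]; rewrite patchE mem_set//= in_itv/=.
  by rewrite (lt_le_trans u0 uy) (le_lt_trans yx x1).
have igx : mu.-integrable `[u, x] (EFin \o derive1 g).
  apply: (@eq_integrable _ _ _ mu _ (measurable_itv _)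
    (EFin \o (derive1 g \_ I01))).
    by move=> y; rewrite inE => /eqG/= ->.
  apply: integrableS ig => //; apply: subset_itvl; rewrite bnd_simp; exact: ltW.
rewrite -[LHS]/(g u + parameterized_integral mu u x (derive1 g \_ I01)).
have -> : parameterized_integral mu u x (derive1 g \_ I01) = g x - g u.
  transitivity (fine (\int[mu]_(y in `[u, x]) (derive1 g y)%:E)%E).
    by congr fine; apply: eq_integral => y; rewrite inE => /eqG/= ->.
  by rewrite integral_derive1.
by rewrite addrC subrK.
Unshelve. all: by end_near. Qed.

(** Monotone convergence along the intervals [t / (n + 1), t], on which
    [ge0_integral_derive1] applies. *)
Lemma integral_derive1_from0 Q (t : R) : 0 < t < 1 ->
  (forall x : R, 0 < x < 1 -> derivable Q x 1) ->
  (forall x : R, 0 < x < 1 -> 0 <= derive1 Q x) ->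
  Q x @[x --> (0 : R)^'+] --> (0 : R) ->
  (\int[mu]_(x in `]0%R, t]) (derive1 Q x)%:E = (Q t)%:E)%E.
Proof.
move=> /andP[t0 t1] dQ Q0 Qcv.
pose a (n : nat) := t / n.+1%:R.
have a0 n : 0 < a n by rewrite divr_gt0.
have at_ n : a n <= t by rewrite ler_pdivrMr// ler_pMr// ler1n.
have in01 n x : `[a n, t]%classic x -> 0 < x < 1.
  by rewrite /= in_itv/= => /andP[ax xt]; rewrite (lt_le_trans (a0 n) ax) (le_lt_trans xt).
have mq n : measurable_fun `[a n, t] (derive1 Q).
  apply: measurable_funS (measurable_fun_derive1 dQ) => //.
  exact: in01.
have Ea : \bigcup_n `[a n, t]%classic = `]0, t]%classic.
  apply/seteqP; split=> x.
    by move=> [n _]; rewrite /= !in_itv/= => /andP[ax ->]; rewrite (lt_le_trans (a0 n)).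
  rewrite /= in_itv/= => /andP[x0 xt].
  exists (Num.truncn (t / x)) => //; rewrite /= in_itv/= xt andbT.
  by rewrite ler_pdivrMr// mulrC -ler_pdivrMr// ltW// truncnS_gt.
have cvI : (\int[mu]_(x in `[a n, t]) (derive1 Q x)%:E @[n --> \oo] -->
    \int[mu]_(x in \bigcup_n `[a n, t]%classic) (derive1 Q x)%:E)%E.
  apply: ge0_nondecreasing_set_cvg_integral.
  - move=> m n mn; apply/subsetPset; apply: subset_itvr; rewrite bnd_simp.
    by rewrite ler_pM2l// lef_pV2 ?posrE// ler_nat.
  - by move=> n; exact: measurable_itv.
  - by move=> n; apply/measurable_EFinP; exact: mq.
  - by move=> n x /in01 x01; rewrite lee_fin Q0.
have : (Q t - Q (a n))%:E @[n --> \oo] --> (Q t)%:E.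
  apply/cvg_EFin; first exact: nearW.
  rewrite -[X in _ --> X]subr0; apply: cvgB; first exact: cvg_cst.
  move/cvg_at_rightP : Qcv; apply; split => //.
  rewrite -(mulr0 t); apply: cvgM; first exact: cvg_cst.
  apply/cvgrPdist_lt => e e0; near=> n; rewrite sub0r normrN gtr0_norm//.
  by near: n; exact: (near_infty_natSinv_lt (PosNum e0)).
rewrite Ea in cvI; move=> cvQ; apply: cvg_unique cvI _ => //.
rewrite (_ : (fun n => _) = (fun n => (Q t - Q (a n))%:E))//.
apply/funext => n; rewrite ge0_integral_derive1//.
- by move=> x /in01; exact: dQ.
- by move=> x /in01; exact: Q0.
Unshelve. all: by end_near. Qed.
End unit_interval.

Section exchange.
Context {R : realType}.
Local Notation mu := (@lebesgue_measure R).
Local Notation I01 := (`]0, 1[%classic : set R).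

(** Integration by parts on ]0, 1[ for the product of [at1 g - g], which
    vanishes at 1, and [Q], which vanishes at 0. Rather than estimating boundary
    terms, the double integral of [phi (u, t)], which is q(u) g'(t) for u <= t
    and 0 otherwise, is computed in both orders. *)
Lemma by_parts_at1 (g Q : R -> R) :
  (forall x : R, 0 < x < 1 -> derivable g x 1) ->
  (forall x : R, 0 < x < 1 -> derivable Q x 1) ->
  (forall u v : R, 0 < u -> u <= v -> v < 1 -> Q u <= Q v) ->
  (forall x : R, 0 < x < 1 -> 0 < Q x) ->
  Q x @[x --> (0 : R)^'+] --> (0 : R) ->
  mu.-integrable I01 (EFin \o (fun x => derive1 g x * Q x)) ->
  [/\ cvg (g x @[x --> (1 : R)^'-]),
    mu.-integrable I01 (EFin \o (fun x => (at1 g - g x) * derive1 Q x)) &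
    (\int[mu]_(x in I01) ((at1 g - g x) * derive1 Q x)%:E =
     \int[mu]_(x in I01) (derive1 g x * Q x)%:E)%E].
Proof.
move=> dg dQ Qmon Qpos Qcv igQ.
have mI : measurable I01 by exact: measurable_itv.
have mg := measurable_fun_derive1 dg.
have mQ := measurable_fun_derive1 dQ.
have q0 (x : R) : 0 < x < 1 -> 0 <= derive1 Q x.
  by move=> x01; apply: (nondecreasing_derive1_ge0 Qmon x01); exact: dQ.
pose G : R -> R := derive1 g \_ I01.
pose q : R -> R := derive1 Q \_ I01.
have GE (x : R) : 0 < x < 1 -> G x = derive1 g x.
  by move=> x01; rewrite /G patchE mem_set//= in_itv/=.
have qE (x : R) : 0 < x < 1 -> q x = derive1 Q x.
  by move=> x01; rewrite /q patchE mem_set//= in_itv/=.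
have GN (x : R) : ~~ (0 < x < 1) -> G x = 0.
  by move=> x01; rewrite /G patchE memNset//= in_itv/=; exact/negP.
have qN (x : R) : ~~ (0 < x < 1) -> q x = 0.
  by move=> x01; rewrite /q patchE memNset//= in_itv/=; exact/negP.
have mG : measurable_fun setT G by apply/(measurable_restrictT (derive1 g) mI).
have mq : measurable_fun setT q by apply/(measurable_restrictT (derive1 Q) mI).
have q_ge0 x : 0 <= q x.
  by have [x01|/qN->//] := boolP (0 < x < 1); rewrite qE// q0.
have iG (u : R) : 0 < u < 1 -> mu.-integrable `[u, 1] (EFin \o G).
  move=> u01; apply: (@integrable_tail _ _ Q) => //; first exact: Qpos.
  by move=> v /andP[uv v1]; apply: Qmon => //; case/andP: u01.
have cvg1 (u : R) (u01 : 0 < u < 1) := cvg_primitive_at1 u01 dg (iG u u01).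
have at1E (u : R) : 0 < u < 1 -> (\int[mu]_(x in `[u, 1%R]) (G x)%:E = (at1 g - g u)%:E)%E.
  move=> u01; rewrite -(fineK (integrable_fin_num _ (iG u u01)))//; congr EFin.
  rewrite /at1 (cvg_lim _ (cvg1 u u01))//.
  by rewrite addrC addKr.
have half01 : 0 < (1 / 2 : R) < 1 by lra.
(* The free factor [c] will be g'(t) for [phi] and |g'(t)| for its absolute
   value. *)
have Iq (t c : R) : 0 < t < 1 ->
    (\int[mu]_u (if u <= t then q u * c else 0)%:E = (c * Q t)%:E)%E.
  move=> t01; have IQ := integral_derive1_from0 t01 dQ q0 Qcv.
  have Iq : (\int[mu]_(u in `]0%R, t]) (q u)%:E = (Q t)%:E)%E.
    rewrite -IQ; apply: eq_integral => u; rewrite inE/= in_itv/= => /andP[u0 ut].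
    by rewrite qE// u0 (le_lt_trans ut)//; case/andP: t01.
  have iq : mu.-integrable `]0, t] (EFin \o q).
    apply/integrableP; split.
      by apply/measurable_EFinP; apply: measurable_funTS.
    under eq_integral do rewrite /= ger0_norm//.
    by rewrite Iq ltry.
  rewrite EFinM -Iq -integralZl//.
  rewrite [RHS]integral_mkcond; apply: eq_integral => u _.
  rewrite patchE mem_setE in_itv/=; case: ifPn => ut; last by rewrite andbF.
  rewrite andbT; case: ifPn => u0; first by rewrite -EFinM mulrC.
  by rewrite qN ?mul0r// negb_and u0.
pose phi (p : R * R) : \bar R := (if p.1 <= p.2 then q p.1 * G p.2 else 0)%:E.
have mphi : measurable_fun setT phi.
  apply/measurable_EFinP; apply: measurable_fun_ifT => //.
    exact: measurable_fun_ler.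
  by apply: measurable_funM; [apply: measurableT_comp mq _|apply: measurableT_comp mG _].
have Ephi1 t : (\int[mu]_u phi (u, t) =
    ((fun x => derive1 g x * Q x) \_ I01 t)%:E)%E.
  have [t01|t01] := boolP (0 < t < 1).
    by rewrite patchE mem_set/= ?in_itv//= -GE// -Iq.
  rewrite patchE memNset/= ?in_itv/=; last exact/negP.
  by rewrite integral0_eq// => u _; rewrite /phi/= GN// mulr0 if_same.
have Eabs t : (\int[mu]_u `|phi (u, t)| =
    `|((fun x => derive1 g x * Q x) \_ I01 t)%:E|)%E.
  have [t01|t01] := boolP (0 < t < 1).
    rewrite patchE mem_set/= ?in_itv//= normrM (gtr0_norm (Qpos _ t01)) -GE//.
    rewrite -Iq//; apply: eq_integral => u _; rewrite /phi/=; congr EFin.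
    by case: ifP => _; rewrite ?normr0// normrM ger0_norm.
  rewrite patchE memNset/= ?in_itv/=; last exact/negP.
  rewrite normr0 integral0_eq// => u _.
  by rewrite /phi/= GN// mulr0 if_same normr0.
have igQT : mu.-integrable setT (EFin \o ((fun x => derive1 g x * Q x) \_ I01)).
  by rewrite -restrict_EFin -integrable_mkcond.
have iphi : (mu \x mu)%E.-integrable setT phi.
  apply/(integrable21ltyP mu mu mphi).
  under eq_integral do rewrite Eabs.
  by move/integrableP : igQT => [].
have Ephi2 u : (\int[mu]_t phi (u, t) =
    ((fun x => (at1 g - g x) * derive1 Q x) \_ I01 u)%:E)%E.
  have [u01|u01] := boolP (0 < u < 1); last first.
    rewrite patchE memNset/= ?in_itv/=; last exact/negP.
    by rewrite integral0_eq// => t _; rewrite /phi/= qN// mul0r if_same.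
  rewrite patchE mem_set/= ?in_itv//= mulrC EFinM -at1E// -qE//.
  rewrite -integralZl//; last exact: iG.
  rewrite [RHS]integral_mkcond; apply: eq_integral => t _.
  rewrite patchE mem_setE in_itv/= /phi/=; case: ifPn => ut //=.
  case: ifPn => t1; first by rewrite EFinM.
  by rewrite GN ?mulr0// negb_and -!leNgt (ltW (_ : 1 < t)) ?orbT// ltNge.
split.
- by apply/cvg_ex; eexists; exact: (cvg1 _ half01).
- rewrite integrable_mkcond// restrict_EFin.
  apply: eq_integrable (integrable_fubini_F iphi) => // u _.
  by rewrite /fubini_F Ephi2.
- rewrite [LHS]integral_mkcond [RHS]integral_mkcond.
  transitivity (\int[mu]_u \int[mu]_t phi (u, t))%E.
    by apply: eq_integral => u _; rewrite Ephi2 -[in RHS]/((EFin \o _) u) -restrict_EFin.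
  rewrite (Fubini iphi); apply: eq_integral => t _.
  by rewrite Ephi1 -[in LHS]/((EFin \o _) t) -restrict_EFin.
Qed.

End exchange.

(** * Expectations under a law with a density *)

Section laws_with_density.
Context {R : realType} d d' {T : measurableType d} {E : measurableType d'}.
Context (P : probability T R) (mu : {sigma_finite_measure set E -> \bar R}).

(** The density [f], extended by 0 outside [D], is almost everywhere the
    Radon-Nikodym derivative of the law of [Z], for which the change of
    variables is known. *)
Lemma ge0_integral_density (Z : T -> E) (D : set E) (f : E -> R)
    (phi : E -> \bar R) :
  measurable_fun setT Z -> measurable D -> measurable_fun D f -> (forall x, D x -> 0 <= f x) ->
  (forall A, measurable A ->
    P (Z @^-1` A) = (\int[mu]_(x in A `&` D) (f x)%:E)%E) ->
  measurable_fun setT phi -> (forall x, (0 <= phi x)%E) ->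
  (\int[P]_w phi (Z w) = \int[mu]_(x in D) (phi x * (f x)%:E))%E.
Proof.
move=> mZ mD mf f0 ZE mphi phi0.
pose Z' : {RV P >-> E} := HB.pack Z (isMeasurableFun.Build _ _ _ _ Z mZ).
rewrite -[LHS](ge0_integral_distribution Z' mphi phi0).
have ll : distribution P Z' `<< mu.
  apply/null_content_dominatesP => A mA muA.
  rewrite [LHS]ZE//; apply: null_set_integral.
  - exact: measurableI.
  - by apply/measurable_EFinP; apply: measurable_funS mf.
  - by apply: (subset_measure0 _ mA _ muA) => //; exact: measurableI.
have mfD : measurable_fun setT ((EFin \o f) \_ D).
  by apply/(measurable_restrictT _ mD); apply/measurable_EFinP.
have fD0 x : (0 <= ((EFin \o f) \_ D) x)%E.
  by apply: erestrict_ge0 => y Dy; rewrite lee_fin f0.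
have ae : ae_eq mu setT (Radon_Nikodym_SigmaFinite.f (distribution P Z') mu)
    ((EFin \o f) \_ D).
  apply: integral_ae_eq => //; first exact: Radon_Nikodym_SigmaFinite.f_integrable.
  move=> A _ mA; rewrite -Radon_Nikodym_SigmaFinite.f_integral//.
  by rewrite -integral_mkcondr -ZE.
rewrite -(Radon_Nikodym_SigmaFinite.change_of_variables ll)//.
rewrite [RHS]integral_mkcond.
transitivity (\int[mu]_x (phi x * ((EFin \o f) \_ D) x))%E; last first.
  apply: eq_integral => x _; rewrite !patchE; case: ifP => // _.
  by rewrite mule0.
apply: ge0_ae_eq_integral => //.
- apply: emeasurable_funM => //.
  exact: (measurable_int _ (Radon_Nikodym_SigmaFinite.f_integrable ll)).
- exact: emeasurable_funM.
- by move=> x _; rewrite mule_ge0// Radon_Nikodym_SigmaFinite.f_ge0.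
- by move=> x _; rewrite mule_ge0.
- by apply: filterS ae => x + Dx => ->.
Qed.

(** Since [f] is nonnegative, the positive and negative parts of [phi * f] are
    those of [phi] times [f]. *)
Lemma expectation_density (Z : T -> E) (D : set E) (f phi : E -> R) :
  measurable_fun setT Z -> measurable D -> measurable_fun D f -> (forall x, D x -> 0 <= f x) ->
  (forall A, measurable A ->
    P (Z @^-1` A) = (\int[mu]_(x in A `&` D) (f x)%:E)%E) ->
  measurable_fun setT phi ->
  mu.-integrable D (EFin \o (fun x => phi x * f x)) ->
  P.-integrable setT (EFin \o (phi \o Z)) /\
  (\int[P]_w (phi (Z w))%:E = \int[mu]_(x in D) (phi x * f x)%:E)%E.
Proof.
move=> mZ mD mf f0 ZE mphi iphi.
have mphiE : measurable_fun setT (EFin \o phi) by apply/measurable_EFinP.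
split.
  apply/integrableP; split; first by apply/measurable_EFinP; exact: measurableT_comp.
  have := @ge0_integral_density Z D f (abse \o (EFin \o phi)) mZ mD mf f0 ZE.
  move=> /(_ (measurableT_comp (@abse_measurable _ _) mphiE) (fun=> abse_ge0 _)) /=.
  move=> ->; move/integrableP : iphi => [_]; apply: le_lt_trans.
  rewrite le_eqVlt; apply/orP; left; apply/eqP; apply: eq_integral => x.
  by rewrite inE => Dx /=; rewrite -EFinM normrM (ger0_norm (f0 x Dx)).
rewrite integralE [RHS]integralE.
have intpos : (\int[P]_w ((fun w => (phi (Z w))%:E)^\+)%E w =
    \int[mu]_(x in D) ((fun x => (phi x * f x)%:E)^\+)%E x)%E.
  have := @ge0_integral_density Z D f ((EFin \o phi)^\+)%E mZ mD mf f0 ZE.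
  move=> /(_ (measurable_funepos mphiE) (fun=> funepos_ge0 _ _)).
  rewrite [X in X = _ -> _](_ : _ =
    (\int[P]_w ((fun w => (phi (Z w))%:E)^\+) w)%E); last first.
    by apply: eq_integral => w _; rewrite !funeposE.
  move=> ->; apply: eq_integral => x; rewrite inE => Dx.
  rewrite !funeposE/= -!EFin_max -EFinM; congr EFin.
  by rewrite maxr_pMl ?mul0r// f0.
have intneg : (\int[P]_w ((fun w => (phi (Z w))%:E)^\-)%E w =
    \int[mu]_(x in D) ((fun x => (phi x * f x)%:E)^\-)%E x)%E.
  have := @ge0_integral_density Z D f ((EFin \o phi)^\-)%E mZ mD mf f0 ZE.
  move=> /(_ (measurable_funeneg mphiE) (fun=> funeneg_ge0 _ _)).
  rewrite [X in X = _ -> _](_ : _ =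
    (\int[P]_w ((fun w => (phi (Z w))%:E)^\-) w)%E); last first.
    by apply: eq_integral => w _; rewrite !funenegE.
  move=> ->; apply: eq_integral => x; rewrite inE => Dx.
  rewrite !funenegE/= -!EFin_max -EFinM; congr EFin.
  by rewrite -mulNr maxr_pMl ?mul0r// f0.
by rewrite intpos intneg.
Qed.

End laws_with_density.

Section laws_on_unit_interval.
Context {R : realType} d {T : measurableType d} (P : probability T R).
Local Notation mu := (@lebesgue_measure R).
Local Notation I01 := (`]0, 1[%classic : set R).

(** Only the values of [k] on ]0, 1[ are seen by [Z], so [k] may be replaced by
    its extension by 0, which is measurable on the whole line. *)
Lemma expectation_density01 (Z : {RV P >-> R}) (f k : R -> R) :
  has_density01 Z f ->
  measurable_fun I01 f -> (forall u : R, 0 < u < 1 -> 0 <= f u) ->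
  measurable_fun I01 k ->
  mu.-integrable I01 (EFin \o (fun u => k u * f u)) ->
  P.-integrable setT (EFin \o (k \o Z)) /\
  ('E_P[k \o Z] = \int[mu]_(u in I01) (k u * f u)%:E)%E.
Proof.
move=> [Z01 Zf] mf f0 mk ikf.
have mI : measurable I01 by exact: measurable_itv.
pose phi : R -> R := k \_ I01.
have phiE u : I01 u -> phi u = k u by move=> u01; rewrite /phi patchE mem_set.
have phiZ : k \o Z = phi \o Z.
  by apply/funext => w /=; rewrite phiE//=; exact: Z01.
have mphi : measurable_fun setT phi by apply/(measurable_restrictT k mI).
have iphi : mu.-integrable I01 (EFin \o (fun u => phi u * f u)).
  by move: ikf; apply: eq_integrable => // u; rewrite inE => /phiE/= ->.
have f0' (u : R) : I01 u -> 0 <= f u by move=> u01; exact: f0.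
have [iZ EZ] := @expectation_density _ _ _ _ (measurableTypeR R) P mu Z I01 f phi
  (measurable_funPT Z) mI mf f0' Zf mphi iphi.
rewrite phiZ; split => //; rewrite unlock.
by rewrite [LHS]EZ; apply: eq_integral => u; rewrite inE => /phiE ->.
Qed.

(** [U] may take the values 0 and 1, where [k] is arbitrary: the extension by 0
    has to start from the closed interval to agree with [k] along [U], whereas
    the law of [U] is carried by the open one. *)
Lemma expectation_uniform01 (U : {RV P >-> R}) (k : R -> R) :
  uniform01 U -> mu.-integrable I01 (EFin \o k) ->
  P.-integrable setT (EFin \o (k \o U)) /\
  ('E_P[k \o U] = \int[mu]_(u in I01) (k u)%:E)%E.
Proof.
move=> [U01 Uunif] ik.
have mI : measurable I01 by exact: measurable_itv.
have mC : measurable (`[0, 1] : set R) by exact: measurable_itv.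
pose phi : R -> R := k \_ `[0, 1].
have phiE (u : R) : 0 <= u <= 1 -> phi u = k u.
  by move=> u01; rewrite /phi patchE mem_set//= in_itv/=.
have phiU : k \o U = phi \o U.
  by apply/funext => w /=; rewrite phiE//=; exact: U01.
have phiI (u : R) : I01 u -> phi u = k u.
  by rewrite /= in_itv/= => /andP[u0 u1]; rewrite phiE// (ltW u0) ltW.
have mk : measurable_fun I01 k by move/integrableP : ik => [/measurable_EFinP].
have mphi : measurable_fun setT phi.
  apply/(measurable_restrictT k mC).
  have -> : `[0, 1]%classic = [set 0 : R] `|` (I01 `|` [set 1 : R]).
    by rewrite setUitv1 ?bnd_simp// setU1itv ?bnd_simp.
  apply/measurable_funU => //; first exact: measurableU.
  split; first exact: measurable_fun_set1.
  by apply/measurable_funU => //; split => //; exact: measurable_fun_set1.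
have iphi : mu.-integrable I01 (EFin \o (fun u => phi u * cst 1 u)).
  by move: ik; apply: eq_integrable => // u; rewrite inE => /phiI/= ->; rewrite mulr1.
have Udist A : measurable A ->
    distribution P U A = (\int[mu]_(u in A `&` I01) (cst 1 u)%:E)%E.
  move=> mA; rewrite Uunif// /uniform_prob integral_uniform_pdf.
  rewrite integral_mkcondl integral_itv_bndoo; last first.
    apply: measurable_funTS; apply/(measurable_restrictT _ mA).
    apply: measurable_funTS; apply/measurable_EFinP.
    exact: measurable_uniform_pdf.
  rewrite -integral_mkcondl; apply: eq_integral => u; rewrite inE => -[_].
  rewrite /= in_itv/= => /andP[u0 u1].
  by rewrite /uniform_pdf (ltW u0) (ltW u1)/= subr0 invr1.
have [iU EU] := @expectation_density _ _ _ _ (measurableTypeR R) P mu U I01 (cst 1) phi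
  (measurable_funPT U) mI
  (measurable_cst _) (fun _ _ => ler01) Udist mphi iphi.
rewrite phiU; split => //; rewrite unlock.
by rewrite [LHS]EU; apply: eq_integral => u; rewrite inE => /phiI ->; rewrite mulr1.
Qed.

End laws_on_unit_interval.

(** * Quantile functions *)

Section quantiles.
Context {R : realType} d {T : measurableType d} (P : probability T R).
Implicit Type X : {RV P >-> R}.

Lemma quantile_set_nonempty X (u : R) : u < 1 ->
  [set x : R | (u%:E <= cdf X x)%E] !=set0.
Proof.
move=> u1; have u1E : (u%:E < 1)%E by rewrite lte_fin.
have [M [_ HM]] := @cvg_cdfy1 _ _ _ _ X _ (open_ereal_gt' u1E).
exists (M + 1); apply: ltW; apply: HM.
by rewrite ltrDl.
Qed.

Lemma quantile_set_has_lbound X (u : R) : 0 < u ->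
  has_lbound [set x : R | (u%:E <= cdf X x)%E].
Proof.
move=> u0; have u0E : (0 < u%:E)%E by rewrite lte_fin.
have [M [_ HM]] := @cvg_cdfNy0 _ _ _ _ X _ (open_ereal_lt' u0E).
exists M => x /= ux.
by rewrite leNgt; apply/negP => /HM /=; rewrite ltNge ux.
Qed.

Lemma quantile_le X (u v : R) : 0 < u -> u <= v -> v < 1 ->
  quantile X u <= quantile X v.
Proof.
move=> u0 uv v1; apply: lb_le_inf; first exact: quantile_set_nonempty.
move=> x /= vx; apply: ge_inf; first exact: quantile_set_has_lbound.
by rewrite /= (le_trans _ vx)// lee_fin.
Qed.

Lemma quantile_ge0 X (u : R) :
  quantile X v @[v --> (0 : R)^'+] --> (0 : R) -> 0 < u < 1 -> 0 <= quantile X u.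
Proof.
move=> X0 /andP[u0 u1].
have <- : lim (quantile X v @[v --> (0 : R)^'+]) = 0 by exact/cvg_lim.
apply: limr_le; first by apply/cvg_ex; exists 0.
near=> v; apply: quantile_le => //.
near: v; exact: nbhs_right_le.
Unshelve. all: by end_near. Qed.

(** A negative point of positive cumulative mass would make some quantile
    negative, so the law charges no negative number; absolute continuity
    excludes an atom at 0. *)
Lemma cdf0_eq0 X : classD X -> cdf X 0 = 0%E.
Proof.
move=> [Xac _ X0 _].
have cdfN (x : R) : x < 0 -> cdf X x = 0%E.
  move=> x0; apply/eqP; rewrite eq_le cdf_ge0 andbT leNgt; apply/negP => cx.
  have cfin : cdf X x \is a fin_num by rewrite fin_num_measure.
  (* The minimum with 1 / 2 keeps the level inside ]0, 1[. *)
  pose v := Num.min (fine (cdf X x)) (1 / 2).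
  have v0 : 0 < v by rewrite lt_min fine_gt0 ?cx ?ltey_eq ?cfin//= divr_gt0.
  have v1 : v < 1 by rewrite gt_min; apply/orP; right; lra.
  have := quantile_ge0 X0 (introT andP (conj v0 v1)); apply/negP; rewrite -ltNge.
  apply: le_lt_trans x0; apply: ge_inf; first exact: quantile_set_has_lbound.
  by rewrite /= -(fineK cfin) lee_fin ge_min lexx.
have X00 : (distribution P X).-negligible [set 0 : R].
  apply/negligibleP; first exact: measurable_set1.
  have /null_content_dominatesP XacE := Xac.
  apply: XacE; first exact: measurable_set1.
  exact: lebesgue_measure_set1.
suff : (distribution P X).-negligible (`]-oo, 0%R] : set R).
  by move=> /negligibleP; apply; exact: measurable_itv.
rewrite (_ : [set` _] = [set 0] `|` \bigcup_n `]-oo, (- n.+1%:R^-1)%R]%classic).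
  apply: negligibleU => //; apply: negligible_bigcup => n.
  apply/negligibleP; first exact: measurable_itv.
  by apply: cdfN; rewrite oppr_lt0.
apply/seteqP; split=> x; rewrite /= in_itv/=.
  rewrite le_eqVlt => /predU1P[->|x0]; [by left|right].
  exists (Num.truncn (- x)^-1) => //; rewrite /= in_itv/= lerNr.
  rewrite -[leRHS]invrK lef_pV2 ?posrE ?invr_gt0 ?oppr_gt0//.
  by rewrite ltW// truncnS_gt.
case=> [->//|[n _]]; rewrite /= in_itv/= => /le_trans; apply.
by rewrite oppr_le0.
Qed.

(** By right continuity at 0, where it vanishes, the cumulative distribution
    function stays below [u] up to some [e > 0]. *)
Lemma quantile_gt0 X (u : R) : classD X -> 0 < u < 1 -> 0 < quantile X u.
Proof.
move=> XD /andP[u0 u1].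
have : cdf X x @[x --> (0 : R)^'+] --> cdf X 0 by exact: cdf_right_continuous.
rewrite (cdf0_eq0 XD) => cdf0; have u0E : (0 < u%:E)%E by rewrite lte_fin.
have near0 := cdf0 _ (open_ereal_lt' u0E).
near (0 : R)^'+ => e.
have e0 : 0 < e by [].
apply: (lt_le_trans e0); apply: lb_le_inf; first exact: quantile_set_nonempty.
move=> x /= ux; rewrite leNgt; apply/negP => /ltW xe.
have : (cdf X e < u%:E)%E by near: e.
by rewrite ltNge (le_trans ux)// cdf_nondecreasing.
Unshelve. all: by end_near. Qed.

End quantiles.

Lemma le_st_quantile (R : realType) (dX dY : measure_display)
    (TX : measurableType dX) (TY : measurableType dY)
    (PX : probability TX R) (PY : probability TY R)
    (X : {RV PX >-> R}) (Y : {RV PY >-> R}) (u : R) :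
  le_st X Y -> 0 < u < 1 -> quantile X u <= quantile Y u.
Proof.
move=> XY /andP[u0 u1]; apply: lb_le_inf; first exact: quantile_set_nonempty.
move=> x /= ux; apply: ge_inf; first exact: quantile_set_has_lbound.
rewrite /= (le_trans ux)// !cdf_1_ccdf leeB//.
Qed.

(** * The identity *)

Theorem theorem3 (R : realType)
  (dX : measure_display) (TX : measurableType dX) (PX : probability TX R)
  (dY : measure_display) (TY : measurableType dY) (PY : probability TY R)
  (dZ : measure_display) (TZ : measurableType dZ) (PZ : probability TZ R)
  (dU : measure_display) (TU : measurableType dU) (PU : probability TU R)
  (X : {RV PX >-> R}) (Y : {RV PY >-> R})
  (Z : {RV PZ >-> R}) (U : {RV PU >-> R}) (g : R -> R)
  (XD : classD X) (YD : classD Y)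
  (XleY : le_st X Y) (EXltEY : ('E_PX[X] < 'E_PY[Y])%E)
  (g_diff : forall u : R, 0 < u < 1 -> derivable g u 1)
  (gQX : (@lebesgue_measure R).-integrable `]0%R, 1%R[
           (EFin \o (fun u => derive1 g u * quantile X u)))
  (gQY : (@lebesgue_measure R).-integrable `]0%R, 1%R[
           (EFin \o (fun u => derive1 g u * quantile Y u)))
  (Zpsi : has_density01 Z (psiL_density X Y))
  (Uunif : uniform01 U) :
  let h := fun u => (at1 g - g u) * (quantile_density Y u - quantile_density X u) in
  [/\ cvg (g u @[u --> (1 : R)^'-]),
      PZ.-integrable [set: TZ] (EFin \o (derive1 g \o Z)),
      PU.-integrable [set: TU] (EFin \o (h \o U)) &
      ('E_PU[h \o U] = 'E_PZ[derive1 g \o Z] * ('E_PY[Y] - 'E_PX[X]))%E].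
Proof.
move=> h.
have [_ iX QX0 dQX] := XD.
have [_ iY QY0 dQY] := YD.
have mI : measurable (`]0%R, 1%R[%classic : set (measurableTypeR R)) by exact: measurable_itv.
have [cvg_g ihX eqX] := by_parts_at1 g_diff dQX (@quantile_le _ _ _ _ X)
  (fun u => quantile_gt0 XD) QX0 gQX.
have [_ ihY eqY] := by_parts_at1 g_diff dQY (@quantile_le _ _ _ _ Y)
  (fun u => quantile_gt0 YD) QY0 gQY.
have EXfin : 'E_PX[X]%E \is a fin_num.
  by rewrite expectation_def; exact: integrable_fin_num iX.
have EYfin : 'E_PY[Y]%E \is a fin_num.
  by rewrite expectation_def; exact: integrable_fin_num iY.
pose D := fine 'E_PY[Y] - fine 'E_PX[X].
have D0 : 0 < D by rewrite subr_gt0 fine_lt.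
have DE : ('E_PY[Y] - 'E_PX[X])%E = D%:E by rewrite EFinB !fineK.
have igYX : (@lebesgue_measure R).-integrable `]0, 1[
    (EFin \o (fun u => derive1 g u * quantile Y u - derive1 g u * quantile X u)).
  exact: integrableB gQY gQX.
have gpsiE u : derive1 g u * psiL_density X Y u =
    D^-1 * (derive1 g u * quantile Y u - derive1 g u * quantile X u).
  by rewrite /psiL_density -/D -mulrBr mulrA mulrC.
have igpsi : (@lebesgue_measure R).-integrable `]0, 1[
    (EFin \o (fun u => derive1 g u * psiL_density X Y u)).
  have := integrableZl mI D^-1 igYX.
  by apply: eq_integrable => // u _ /=; rewrite gpsiE.
have [iZ EZ] : PZ.-integrable [set: TZ] (EFin \o (derive1 g \o Z)) /\
    ('E_PZ[derive1 g \o Z] = \int[@lebesgue_measure R]_(u in `]0%R, 1%R[)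
       (derive1 g u * psiL_density X Y u)%:E)%E.
  apply: expectation_density01 => //.
  - apply: measurable_funM => //.
    by apply: measurable_funB; exact: measurable_fun_derivable.
  - move=> u u01; apply: mulr_ge0; last by rewrite invr_ge0 ltW.
    by rewrite subr_ge0 le_st_quantile.
  - exact: measurable_fun_derive1.
have ih : (@lebesgue_measure R).-integrable `]0, 1[ (EFin \o h).
  have := integrableB mI ihY ihX.
  by apply: eq_integrable => // u _ /=; rewrite /h mulrBr.
have [iU EU] := expectation_uniform01 Uunif ih.
split => //.
rewrite DE EU EZ.
transitivity (\int[@lebesgue_measure R]_(u in `]0%R, 1%R[)
    (derive1 g u * quantile Y u - derive1 g u * quantile X u)%:E)%E.
  rewrite [RHS]integralB_EFin// -eqY -eqX -integralB_EFin//.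
  by apply: eq_integral => u _; rewrite /h mulrBr.
under [in RHS]eq_integral do rewrite gpsiE EFinM.
rewrite integralZl// muleC muleA -EFinM divff ?mul1e//.
by rewrite gt_eqF.
Qed.
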